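(* Let $\mathcal{X}$ be a finite nonempty set. A sequence $(\hat{W}_n)_{n\geq 0}$ in $\mathrm{DMC}_{\mathcal{X},\ast}^{(o)}$ converges in $(\mathrm{DMC}_{\mathcal{X},\ast}^{(o)},\mathcal{T}_{s,\mathcal{X},\ast}^{(o)})$ if and only if there exists $m\geq 1$ such that $\hat{W}_n\in \mathrm{DMC}_{\mathcal{X},[m]}^{(o)}$ for every $n\geq 0$, and $(\hat{W}_n)_{n\geq 0}$ converges in $(\mathrm{DMC}_{\mathcal{X},[m]}^{(o)},\mathcal{T}_{\mathcal{X},[m]}^{(o)})$.
   Context: For finite nonempty sets $\mathcal{X},\mathcal{Y}$, $\mathrm{DMC}_{\mathcal{X},\mathcal{Y}}$ is the set of channels from $\mathcal{X}$ to $\mathcal{Y}$, i.e. functions $W:\mathcal{X}\times\mathcal{Y}\to[0,1]$, written $W(y|x)$, with $\sum_{y\in\mathcal{Y}}W(y|x)=1$ for every $x\in\mathcal{X}$. It carries the topology $\mathcal{T}_{\mathcal{X},\mathcal{Y}}$ inherited from the Euclidean topology of $\mathbb{R}^{\mathcal{X}\times\mathcal{Y}}$. For $W\in\mathrm{DMC}_{\mathcal{X},\mathcal{Y}}$ and $V\in\mathrm{DMC}_{\mathcal{Y},\mathcal{Z}}$, the composition $V\circ W\in\mathrm{DMC}_{\mathcal{X},\mathcal{Z}}$ is $(V\circ W)(z|x)=\sum_{y\in\mathcal{Y}}V(z|y)W(y|x)$. A channel $W'\in\mathrm{DMC}_{\mathcal{X},\mathcal{Z}}$ is degraded from $W\in\mathrm{DMC}_{\mathcal{X},\mathcal{Y}}$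 if $W'=V\circ W$ for some $V\in\mathrm{DMC}_{\mathcal{Y},\mathcal{Z}}$; $W$ and $W'$ are equivalent if each is degraded from the other. $\mathrm{DMC}_{\mathcal{X},\mathcal{Y}}^{(o)}$ is the quotient of $\mathrm{DMC}_{\mathcal{X},\mathcal{Y}}$ by this equivalence relation, with the quotient topology $\mathcal{T}_{\mathcal{X},\mathcal{Y}}^{(o)}$. Let $[n]=\{1,\dots,n\}$, let $\mathrm{DMC}_{\mathcal{X},\ast}=\coprod_{n\ge1}\mathrm{DMC}_{\mathcal{X},[n]}$, and let $\mathrm{DMC}_{\mathcal{X},\ast}^{(o)}$ be the quotient set of $\mathrm{DMC}_{\mathcal{X},\ast}$ by equivalence of channels. For each $n\geq 1$, $\mathrm{DMC}_{\mathcal{X},[n]}^{(o)}$ is identified with the subset of $\mathrm{DMC}_{\mathcal{X},\ast}^{(o)}$ consisting of the classes containing a channel with output alphabet $[n]$; these subsets increase with $n$ and their union is $\mathrm{DMC}_{\mathcal{X},\ast}^{(o)}$. The strong topology $\mathcal{T}_{s,\mathcal{X},\ast}^{(o)}$ is the quotient topology on $\mathrm{DMC}_{\mathcal{X},\ast}^{(o)}$ of the disjoint union topology $\bigoplus_{n\ge1}\mathcal{T}_{\mathcal{X},[n]}$ on $\mathrm{DMC}_{\mathcal{X},\ast}$. *)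

(* Defs.v *)
From HB Require Import structures.
From mathcomp Require Import all_boot all_order all_algebra.
From mathcomp Require Import all_classical all_reals all_analysis.

Set Implicit Arguments.
Unset Strict Implicit.
Unset Printing Implicit Defensive.

Import Order.TTheory GRing.Theory Num.Theory numFieldNormedType.Exports.

Local Open Scope classical_set_scope.
Local Open Scope ring_scope.
Local Open Scope quotient_scope.

(* W (x, y) is the transition probability W(y|x). The topology that [dmc]
   receives from [set_type] is the one induced by the product topology on
   R^(X * Y), which is the Euclidean one since X * Y is finite. *)
Definition is_channel (R : realType) (X Y : finType) :
    set {ptws X * Y -> R} :=
  [set W | (forall x y, 0 <= W (x, y) <= 1) /\
           (forall x, \sum_(y : Y) W (x, y) = 1)].

Definition dmc (R : realType) (X Y : finType) : topologicalType :=
  set_type (@is_channel R X Y).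

Section composition.
Variable R : realType.

Definition channel_fun (X Y : finType) (W : dmc R X Y) : X * Y -> R :=
  set_val W.

Lemma channel_funP (X Y : finType) (W : dmc R X Y) :
  is_channel (channel_fun W : {ptws X * Y -> R}).
Proof. exact: set_valP. Qed.

Lemma channel_fun_inj (X Y : finType) : injective (@channel_fun X Y).
Proof. exact: val_inj. Qed.

Lemma is_channel_ge0 (X Y : finType) (W : {ptws X * Y -> R}) :
  (forall x y, 0 <= W (x, y)) -> (forall x, \sum_y W (x, y) = 1) ->
  is_channel W.
Proof.
move=> W0 W1; split=> // x y; rewrite W0 /= -(W1 x) (bigD1 y) //= lerDl.
exact: sumr_ge0.
Qed.

Definition comp_fun (X Y Z : finType) (V : dmc R Y Z) (W : dmc R X Y) :
    {ptws X * Z -> R} :=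
  fun xz => \sum_(y : Y) channel_fun V (y, xz.2) * channel_fun W (xz.1, y).

Lemma comp_fun_channel (X Y Z : finType) (V : dmc R Y Z) (W : dmc R X Y) :
  is_channel (comp_fun V W).
Proof.
have [V0 V1] := channel_funP V; have [W0 W1] := channel_funP W.
apply: is_channel_ge0 => [x z|x].
  apply: sumr_ge0 => y _.
  by apply: mulr_ge0; [case/andP: (V0 y z)|case/andP: (W0 x y)].
rewrite /comp_fun exchange_big /= -(W1 x); apply: eq_bigr => y _.
by rewrite -mulr_suml V1 mul1r.
Qed.

Definition dmc_comp (X Y Z : finType) (V : dmc R Y Z) (W : dmc R X Y) :
    dmc R X Z :=
  SigSub (mem_set (comp_fun_channel V W)).

Definition id_fun (X : finType) : {ptws X * X -> R} :=
  fun xx => (xx.1 == xx.2)%:R.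

Lemma id_fun_channel (X : finType) : is_channel (@id_fun X).
Proof.
apply: is_channel_ge0 => [x y|x]; first exact: ler0n.
rewrite /id_fun (bigD1 x) //= eqxx big1 ?addr0// => y.
by rewrite eq_sym => /negbTE ->.
Qed.

Definition dmc_id (X : finType) : dmc R X X :=
  SigSub (mem_set (@id_fun_channel X)).

Lemma dmc_compE (X Y Z : finType) (V : dmc R Y Z) (W : dmc R X Y) x z :
  channel_fun (dmc_comp V W) (x, z) =
  \sum_(y : Y) channel_fun V (y, z) * channel_fun W (x, y).
Proof. by []. Qed.

Lemma dmc_idE (X : finType) (x x' : X) :
  channel_fun (dmc_id X) (x, x') = (x == x')%:R.
Proof. by []. Qed.

Lemma dmc_comp1 (X Y : finType) (W : dmc R X Y) : dmc_comp (dmc_id Y) W = W.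
Proof.
apply: channel_fun_inj; apply/funext => -[x z].
rewrite dmc_compE (bigD1 z) //= dmc_idE eqxx mul1r big1 ?addr0// => y yz.
by rewrite dmc_idE (negbTE yz) mul0r.
Qed.

Lemma dmc_compA (X Y Z T : finType)
    (U : dmc R Z T) (V : dmc R Y Z) (W : dmc R X Y) :
  dmc_comp U (dmc_comp V W) = dmc_comp (dmc_comp U V) W.
Proof.
apply: channel_fun_inj; apply/funext => -[x t]; rewrite !dmc_compE.
under eq_bigr do rewrite dmc_compE mulr_sumr.
rewrite exchange_big /=; apply: eq_bigr => y _.
by rewrite dmc_compE mulr_suml; apply: eq_bigr => z _; rewrite mulrA.
Qed.

(* [degraded W W'] : W' is degraded from W. *)
Definition degraded (X Y Z : finType) (W : dmc R X Y) (W' : dmc R X Z) : Prop :=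
  exists V : dmc R Y Z, W' = dmc_comp V W.

Definition equivalent (X Y Z : finType)
    (W : dmc R X Y) (W' : dmc R X Z) : Prop :=
  degraded W W' /\ degraded W' W.

Lemma degraded_refl (X Y : finType) (W : dmc R X Y) : degraded W W.
Proof. by exists (dmc_id Y); rewrite dmc_comp1. Qed.

Lemma degraded_trans (X Y Z T : finType)
    (W : dmc R X Y) (W' : dmc R X Z) (W'' : dmc R X T) :
  degraded W W' -> degraded W' W'' -> degraded W W''.
Proof.
by move=> [V ->] [U ->]; exists (dmc_comp U V); rewrite dmc_compA.
Qed.

Lemma equivalent_refl (X Y : finType) (W : dmc R X Y) : equivalent W W.
Proof. by split; exact: degraded_refl. Qed.

Lemma equivalent_sym (X Y Z : finType) (W : dmc R X Y) (W' : dmc R X Z) :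
  equivalent W W' -> equivalent W' W.
Proof. by case. Qed.

Lemma equivalent_trans (X Y Z T : finType)
    (W : dmc R X Y) (W' : dmc R X Z) (W'' : dmc R X T) :
  equivalent W W' -> equivalent W' W'' -> equivalent W W''.
Proof.
by move=> [a b] [c d]; split; [exact: degraded_trans c|exact: degraded_trans b].
Qed.

End composition.

Section quotient_fixed_output.
Variables (R : realType) (X Y : finType).

Definition dmc_equiv (W W' : dmc R X Y) : bool := `[< equivalent W W' >].

Lemma dmc_equiv_refl : reflexive dmc_equiv.
Proof. by move=> W; apply/asboolP; exact: equivalent_refl. Qed.

Lemma dmc_equiv_sym : symmetric dmc_equiv.
Proof.
by move=> W W'; apply/asboolP/asboolP; exact: equivalent_sym.
Qed.

Lemma dmc_equiv_trans : transitive dmc_equiv.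
Proof.
move=> W' W W'' /asboolP h /asboolP k; apply/asboolP.
exact: equivalent_trans h k.
Qed.

Canonical dmc_equiv_rel :=
  EquivRel dmc_equiv dmc_equiv_refl dmc_equiv_sym dmc_equiv_trans.

Definition dmc_o : topologicalType :=
  quotient_topology {eq_quot dmc_equiv_rel}.

End quotient_fixed_output.

Section quotient_any_output.
Variables (R : realType) (X : finType).

(* The output alphabet [n + 1] is 'I_n.+1, so that n : nat ranges over exactly
   the alphabets [1], [2], ... *)
Definition dmc_star : topologicalType := {n : nat & dmc R X 'I_n.+1}.

Definition dmc_star_equiv (W W' : dmc_star) : bool :=
  `[< equivalent (projT2 W) (projT2 W') >].

Lemma dmc_star_equiv_refl : reflexive dmc_star_equiv.
Proof. by move=> W; apply/asboolP; exact: equivalent_refl. Qed.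

Lemma dmc_star_equiv_sym : symmetric dmc_star_equiv.
Proof.
by move=> W W'; apply/asboolP/asboolP; exact: equivalent_sym.
Qed.

Lemma dmc_star_equiv_trans : transitive dmc_star_equiv.
Proof.
move=> W' W W'' /asboolP h /asboolP k; apply/asboolP.
exact: equivalent_trans h k.
Qed.

Canonical dmc_star_equiv_rel := EquivRel dmc_star_equiv
  dmc_star_equiv_refl dmc_star_equiv_sym dmc_star_equiv_trans.

(* The topology of this quotient is the strong topology. *)
Definition dmc_star_o : topologicalType :=
  quotient_topology {eq_quot dmc_star_equiv_rel}.

Definition star_class (n : nat) (W : dmc R X 'I_n.+1) : dmc_star_o :=
  \pi_(dmc_star_o) (existT _ n W : dmc_star).

Definition has_output (n : nat) : set dmc_star_o :=
  [set w | exists W : dmc R X 'I_n.+1, w = star_class W].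

(* The identification of dmc_o R X 'I_n.+1 with has_output n; it does not
   depend on the representative, is injective, and is onto has_output n. *)
Definition dmc_o_incl (n : nat) (w : dmc_o R X 'I_n.+1) : dmc_star_o :=
  star_class (repr w).

Lemma dmc_o_incl_pi (n : nat) (W : dmc R X 'I_n.+1) :
  dmc_o_incl (\pi_(dmc_o R X 'I_n.+1) W) = star_class W.
Proof.
apply/eqmodP/asboolP => /=; apply/asboolP.
by have /eqmodP := reprK (\pi_(dmc_o R X 'I_n.+1) W).
Qed.

Lemma dmc_o_incl_inj (n : nat) : injective (@dmc_o_incl n).
Proof.
move=> u v /eqmodP/asboolP /= uv.
by rewrite -(reprK u) -(reprK v); apply/eqmodP/asboolP.
Qed.

Lemma range_dmc_o_incl (n : nat) : range (@dmc_o_incl n) = has_output n.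
Proof.
apply/seteqP; split=> [_ [u _ <-]|_ [W ->]]; first by exists (repr u).
by exists (\pi_(dmc_o R X 'I_n.+1) W) => //; rewrite dmc_o_incl_pi.
Qed.

End quotient_any_output.

(* Main.v *)
(* Channels with fixed finite alphabets form a compact Hausdorff space, and
   composition is continuous, so the saturation of a closed set of channels under
   equivalence is closed, even between different output alphabets. Hence the
   inclusions of the dmc_o R X 'I_m.+1 into dmc_star_o R X are closed embeddings
   and the points of dmc_star_o R X are closed. If a sequence converging to w were
   contained in no has_output m, some of its terms would form a set, avoiding w,
   that meets every has_output m in a finite set; such a set is closed, which
   contradicts convergence. *)

Require Import Defs.
From mathcomp Require Import all_boot all_order all_algebra.
From mathcomp Require Import all_classical all_reals all_analysis.

Set Implicit Arguments.
Unset Strict Implicit.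
Unset Printing Implicit Defensive.

Import Order.TTheory GRing.Theory Num.Theory numFieldNormedType.Exports.

Local Open Scope classical_set_scope.
Local Open Scope ring_scope.
Local Open Scope quotient_scope.

(** * Compactness and separation for channels with fixed alphabets *)

Section topology_of_channels.
Variable R : realType.
Implicit Types X Y Z : finType.

Lemma continuous_channel_fun X Y (xy : X * Y) :
  continuous (fun W : dmc R X Y => channel_fun W xy).
Proof.
move=> W; apply: (@continuous_comp _ {ptws X * Y -> R} _ set_val (proj xy)).
  exact: initial_continuous.
exact: proj_continuous.
Qed.

(** The pointwise topology is the supremum of the topologies pulled back along the evaluations, and
    each evaluation is onto [R], so convergence can be tested on images. *)
Lemma cvg_ptws (T I : Type) (F : set_system T) (f : T -> {ptws I -> R})
    (g : {ptws I -> R}) :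
  Filter F -> (forall i, (fun t => f t i) @ F --> g i) -> f @ F --> g.
Proof.
move=> FF fg; apply/cvg_sup => i; apply/cvg_image.
  by apply/seteqP; split=> // r _; exists (fun=> r).
move=> A /fg FA; exists ((fun h : I -> R => h i) @^-1` A); first exact: FA.
by apply: image_preimage; apply/seteqP; split=> // r _; exists (fun=> r).
Qed.

Lemma continuous_dmc (T : topologicalType) X Y (f : T -> dmc R X Y) :
  (forall x y, continuous (fun t => channel_fun (f t) (x, y))) -> continuous f.
Proof.
move=> cf; apply: continuous_comp_initial => t.
by apply: cvg_ptws => -[x y]; exact: cf.
Qed.

Lemma dmc_hausdorff X Y : hausdorff_space (dmc R X Y).
Proof.
move=> U V UV; apply: channel_fun_inj; apply/funext => xy.
apply: (@Rhausdorff R); move=> A B nA nB.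
have [W [AW BW]] := UV _ _ (continuous_channel_fun nA)
  (continuous_channel_fun nB).
by exists (channel_fun W xy).
Qed.

Lemma continuous_sumr (T : topologicalType) (I : finType) (f : I -> T -> R) :
  (forall i, continuous (f i)) -> continuous (fun t => \sum_i f i t).
Proof.
move=> cf; apply: (@continuous_big R I +%R 0 xpredT _ T) => //.
exact: (@add_continuous R^o).
Qed.

Lemma closed_is_channel X Y : closed (@is_channel R X Y).
Proof.
have cp xy : continuous (fun W : {ptws X * Y -> R} => W xy).
  exact: (@proj_continuous _ (fun=> R)).
have -> : @is_channel R X Y =
    \bigcap_(x : X) [set W | \sum_y W (x, y) = 1] `&`
    \bigcap_(xy : X * Y) [set W | 0 <= W xy <= 1].
  apply/seteqP; split=> W.
    by move=> [W0 W1]; split=> [x _|[x y] _]; [exact: W1|exact: W0].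
  by move=> [W1 W0]; split=> [x y|x]; [exact: (W0 (x, y))|exact: W1].
apply: closedI; last first.
  apply: closed_bigI => xy _.
  apply: (@preimage_closed {ptws X * Y -> R} R (fun W => W xy)
    [set r | 0 <= r <= 1]).
    by move=> W _; exact: cp.
  have -> : [set r : R | 0 <= r <= 1] = `[0, 1]%classic.
    by apply/seteqP; split=> r /=; rewrite in_itv.
  exact: interval_closed.
apply: closed_bigI => x _.
apply: (@preimage_closed {ptws X * Y -> R} R (fun W => \sum_y W (x, y))
  [set 1]).
  by move=> W _; apply: continuous_sumr => y; exact: cp.
exact: closed_eq.
Qed.

Lemma compact_is_channel X Y : compact (@is_channel R X Y).
Proof.
have cI := @tychonoff (X * Y)%type (fun=> R) (fun=> `[0, 1]%classic)
  (fun=> @segment_compact R 0 1).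
apply: (subclosed_compact (@closed_is_channel X Y) cI) => W [W0 _] [x y] /=.
by rewrite in_itv; exact: W0.
Qed.

(** Pushed along [set_val], the filter clusters at a point that is itself a channel; as the open
    sets of the subtype are traces of open sets, it clusters there in the subtype too. *)
Lemma dmc_compact X Y : compact [set: dmc R X Y].
Proof.
move=> F PF _.
pose G : set_system {ptws X * Y -> R} := @set_val _ (@is_channel R X Y) @ F.
have [|W [cW clW]] := @compact_is_channel X Y G (fmap_proper_filter _ PF).
  by apply: (@filterS _ F _ setT) filterT => W _; exact: channel_funP.
exists (SigSub (mem_set cW)); split=> // A N FA [_ [[B oB <-] BW] BN].
have [||_ [[U AU <-] BU]] := clW (set_val @` A) B.
- by apply: (@filterS _ F _ A) FA => U AU; exists U.
- exact: open_nbhs_nbhs.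
by exists U; split=> //; exact: BN.
Qed.

Lemma continuous_dmc_comp (T : topologicalType) X Y Z
    (V : T -> dmc R Y Z) (W : T -> dmc R X Y) :
  continuous V -> continuous W -> continuous (fun t => dmc_comp (V t) (W t)).
Proof.
move=> cV cW; apply: continuous_dmc => x z.
apply: continuous_sumr => y t.
apply: cvgM.
  by exact: (cvg_comp _ _ (cV t) (@continuous_channel_fun _ _ _ _)).
by exact: (cvg_comp _ _ (cW t) (@continuous_channel_fun _ _ _ _)).
Qed.

Lemma hausdorff_closed_eq (S T : topologicalType) (f g : S -> T) :
  hausdorff_space T -> continuous f -> continuous g ->
  closed [set s | f s = g s].
Proof.
move=> hT cf cg s cl; apply: hT => A B nA nB.
have nAB : nbhs s ((f @^-1` A) `&` (g @^-1` B)).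
  by apply: filterI; [exact: cf|exact: cg].
have [t [/= fg [At Bt]]] := cl _ nAB.
by exists (f t); split=> //; rewrite fg.
Qed.

(* The saturation of K is the image under (W, V, U) |-> V o W of the compact
   set of the triples with W in K and U o (V o W) = W. *)
Lemma closed_equivalent X Y Z (K : set (dmc R X Y)) :
  closed K -> closed [set W' : dmc R X Z | exists2 W, K W & equivalent W W'].
Proof.
move=> cK.
pose T := (dmc R X Y * dmc R Y Z * dmc R Z Y)%type.
pose f (t : T) := dmc_comp t.1.2 t.1.1.
have cW : continuous (fun t : T => t.1.1).
  by move=> t; apply: continuous_comp; exact: cvg_fst.
have cV : continuous (fun t : T => t.1.2).
  by move=> t; apply: continuous_comp; [exact: cvg_fst|exact: cvg_snd].
have cU : continuous (fun t : T => t.2) by move=> t; exact: cvg_snd.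
have cf : continuous f by exact: continuous_dmc_comp.
pose C := [set t : T | K t.1.1] `&` [set t | t.1.1 = dmc_comp t.2 (f t)].
have -> : [set W' : dmc R X Z | exists2 W, K W & equivalent W W'] = f @` C.
  apply/seteqP; split=> [W' [W KW [[V VE] [U UE]]]|_ [[[W V] U] [/= KW WE] <-]].
    by exists (W, V, U); rewrite /f//=; split; rewrite //= /f/= -VE.
  by exists W => //; split; [exists V|exists U].
apply: compact_closed; first exact: dmc_hausdorff.
apply: continuous_compact; first exact: continuous_subspaceT.
apply: subclosed_compact (subsetT C); last first.
  rewrite -!setXTT; apply: compact_setX; last exact: dmc_compact.
  by apply: compact_setX; exact: dmc_compact.
apply: closedI; first by apply: preimage_closed => // t _; exact: cW.
apply: hausdorff_closed_eq => //; first exact: dmc_hausdorff.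
exact: continuous_dmc_comp.
Qed.

End topology_of_channels.

(** * Relabelling of outputs *)

Section deterministic_channels.
Variable R : realType.
Implicit Types X Y Z : finType.

Definition det_fun X Y (f : X -> Y) : {ptws X * Y -> R} :=
  fun xy => (f xy.1 == xy.2)%:R.

Lemma det_fun_channel X Y (f : X -> Y) : is_channel (det_fun f).
Proof.
apply: is_channel_ge0 => [x y|x]; first exact: ler0n.
rewrite /det_fun (bigD1 (f x)) //= eqxx big1 ?addr0// => y.
by rewrite eq_sym => /negbTE ->.
Qed.

Definition dmc_det X Y (f : X -> Y) : dmc R X Y :=
  SigSub (mem_set (det_fun_channel f)).

Lemma dmc_detE X Y (f : X -> Y) x y :
  channel_fun (dmc_det f) (x, y) = (f x == y)%:R.
Proof. by []. Qed.

Lemma dmc_det_comp X Y (f : X -> Y) (g : Y -> X) :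
  cancel f g -> dmc_comp (dmc_det g) (dmc_det f) = dmc_id R X.
Proof.
move=> fK; apply: channel_fun_inj; apply/funext => -[x x'].
rewrite dmc_compE dmc_idE (bigD1 (f x)) //= big1 ?addr0 => [|y yx].
  by rewrite !dmc_detE eqxx mulr1 fK.
by rewrite !dmc_detE (eq_sym (f x)) (negbTE yx) mulr0.
Qed.

(** An injective relabelling of the outputs loses nothing: its left inverse undoes it. *)
Lemma equivalent_det X Y Z (f : Y -> Z) (g : Z -> Y) (W : dmc R X Y) :
  cancel f g -> equivalent W (dmc_comp (dmc_det f) W).
Proof.
move=> fK; split; first by exists (dmc_det f).
by exists (dmc_det g); rewrite dmc_compA dmc_det_comp// dmc_comp1.
Qed.

End deterministic_channels.

(** * Closed sets and convergence in the strong topology *)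

Section strong_topology.
Variables (R : realType) (X : finType).
Local Notation dmc_star_o := (dmc_star_o R X).
Local Notation has_output := (@has_output R X).
Local Notation dmc_o n := (dmc_o R X 'I_n.+1).

Lemma star_class_eq n m (U : dmc R X 'I_n.+1) (V : dmc R X 'I_m.+1) :
  star_class U = star_class V <-> equivalent U V.
Proof. by split=> [/eqmodP/asboolP//|?]; apply/eqmodP/asboolP. Qed.

Lemma has_output_le m n : (m <= n)%N -> has_output m `<=` has_output n.
Proof.
move=> mn w [W ->].
(* The added letters have probability zero, so the default value that [inord] gives them is
   harmless. *)
pose f := @widen_ord m.+1 n.+1 mn.
have fK : cancel f (fun i => inord i).
  by move=> i; apply: val_inj; rewrite /= inordK.
exists (dmc_comp (dmc_det R f) W); apply/star_class_eq.
exact: equivalent_det fK.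
Qed.

Lemma has_output_ex (w : dmc_star_o) : exists m, has_output m w.
Proof.
rewrite -(reprK w); case: (repr w) => m W; by exists m, W.
Qed.

(** A quotient of a disjoint union carries the final topology of the maps [star_class]. *)
Lemma closed_star_oP (A : set dmc_star_o) :
  closed A <-> forall n, closed (@star_class R X n @^-1` A).
Proof.
rewrite -openC; split=> [oA n|cA].
  by rewrite -openC; move/sigT_openP: oA; exact.
by apply/sigT_openP => n; have := cA n; rewrite -openC.
Qed.

Lemma continuous_dmc_o_incl m : continuous (@dmc_o_incl R X m).
Proof.
apply/quotient_continuous => U.
have -> : @dmc_o_incl R X m \o \pi_(dmc_o m) = @star_class R X m.
  by apply/funext => V; exact: dmc_o_incl_pi.
apply: (@continuous_comp _ (dmc_star R X)).
  exact: (@existT_continuous _ (fun n => dmc R X 'I_n.+1)).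
exact: pi_continuous.
Qed.

(** Pulled back to the output alphabet ['I_n.+1], the image becomes the saturation of [K] there,
    which compactness makes closed. *)
Lemma closed_star_class_image m (K : set (dmc R X 'I_m.+1)) :
  closed K -> closed (@star_class R X m @` K).
Proof.
move=> cK; apply/closed_star_oP => n.
rewrite (_ : _ @^-1` _ =
    [set W' | exists2 W, K W & equivalent W W']); first exact: closed_equivalent.
by apply/seteqP; split=> W' [W KW /star_class_eq E]; exists W.
Qed.

Lemma closed_star_o_set1 (w : dmc_star_o) : closed [set w].
Proof.
have [m [W ->]] := has_output_ex w.
rewrite -(image_set1 (@star_class R X m)); apply: closed_star_class_image.
exact/accessible_closed_set1/hausdorff_accessible/dmc_hausdorff.
Qed.

Lemma closed_dmc_o_incl_image m (C : set (dmc_o m)) :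
  closed C -> closed (@dmc_o_incl R X m @` C).
Proof.
move=> cC.
have -> : @dmc_o_incl R X m @` C =
    @star_class R X m @` (\pi_(dmc_o m) @^-1` C).
  apply/seteqP; split=> [_ [v Cv <-]|_ [V CV <-]].
    by exists (repr v) => //=; rewrite reprK.
  by exists (\pi V) => //; exact: dmc_o_incl_pi.
apply: closed_star_class_image; apply: preimage_closed => // V _.
exact: pi_continuous.
Qed.

(** An open [G] around [v] is the trace of an open set of the large space: the complement of the
    closed image of the complement of [G]. *)
Lemma dmc_o_incl_cvg m (u : nat -> dmc_o m) (v : dmc_o m) :
  (fun n => dmc_o_incl (u n)) @ \oo --> dmc_o_incl v -> u @ \oo --> v.
Proof.
move=> cu A; rewrite nbhsE => -[G [oG Gv] GA].
have oI : open (~` (@dmc_o_incl R X m @` (~` G))).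
  by rewrite openC; apply/closed_dmc_o_incl_image/open_closedC.
have : \forall n \near \oo,
    (~` (@dmc_o_incl R X m @` (~` G))) (dmc_o_incl (u n)).
  apply: cu; apply: open_nbhs_nbhs; split=> // -[v' Gv' /dmc_o_incl_inj vv'].
  by apply: Gv'; rewrite vv'.
move=> [N _ NI]; exists N => // n /NI Iu; apply: GA; apply: contrapT => nG.
by apply: Iu; exists (u n).
Qed.

Lemma cvg_has_output (W : nat -> dmc_star_o) (w : dmc_star_o) :
  W @ \oo --> w -> exists m, forall n, has_output m (W n).
Proof.
move=> Ww; have [m0 wm0] := has_output_ex w.
(* Having [m0] in the bound puts [w] in [has_output (maxn N m0)] for every [N], so a term outside
   that set differs from [w]. *)
have [[N Nm]|unb] := pselect (exists N, forall n, (N <= n)%N ->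
    has_output (maxn N m0) (W n)).
  have [r rW] := choice (fun n => has_output_ex (W n)).
  (* The inner [maxn] handles the tail; the finitely many terms before [N] are absorbed by the
     maximum of their own alphabet sizes. *)
  exists (maxn (maxn N m0) (\max_(i < N) r i)) => n.
  have [/Nm|nN] := leqP N n; first exact/has_output_le/leq_maxl.
  apply: has_output_le (rW n); apply: leq_trans (leq_maxr _ _).
  exact: (leq_bigmax (Ordinal nN)).
have /choice[s sP] : forall k, exists n,
    (k <= n)%N /\ ~ has_output (maxn k m0) (W n).
  move=> k; apply: contrapT => nk; apply: unb; exists k => n kn.
  by apply: contrapT => nW; apply: nk; exists n.
pose A := range (W \o s).
(* As W (s i) is outside has_output k for k <= i, A meets each has_output k in
   a finite set. *)
have cA : closed A.
  apply/closed_star_oP => k.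
  rewrite (_ : _ @^-1` _ = \bigcup_(i in `I_k)
      (@star_class R X k @^-1` [set W (s i)])).
    apply: closed_bigcup; first exact: finite_II.
    by move=> i _; move: k; apply/closed_star_oP/closed_star_o_set1.
  apply/seteqP; split=> [V [i _ /= Vi]|V [i _ /= ->]]; last by exists i.
  exists i => //=; rewrite ltnNge; apply/negP => ki; have [_] := sP i; apply.
  apply: (@has_output_le k); first exact: leq_trans (leq_maxl _ _).
  by exists V.
have /Ww [N _ NA] : nbhs w (~` A).
  apply: open_nbhs_nbhs; split; first exact: closed_openC.
  move=> [i _ /= wE]; have [_] := sP i; apply.
  by rewrite wE; apply: has_output_le wm0; exact: leq_maxr.
(* As [N <= s N], the term [W (s N)] belongs to the tail that avoids [A], yet lies in [A]. *)
have [Ns _] := sP N.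
by case: (NA _ Ns); exists N.
Qed.

End strong_topology.

Theorem proposition9 (R : realType) (X : finType) (X_gt0 : (0 < #|X|)%N)
    (W : nat -> dmc_star_o R X) :
  (exists w : dmc_star_o R X, W @ \oo --> w) <->
  (exists m : nat,
     (forall n : nat, @has_output R X m (W n)) /\
     exists2 u : nat -> dmc_o R X 'I_m.+1,
       (forall n : nat, dmc_o_incl (u n) = W n) &
       exists v : dmc_o R X 'I_m.+1, u @ \oo --> v).
Proof.
split=> [[w Ww]|[m [_ [u uW [v uv]]]]]; last first.
  exists (dmc_o_incl v).
  have -> : W = @dmc_o_incl R X m \o u by apply/funext => n /=; rewrite uW.
  exact: (cvg_comp _ _ uv (@continuous_dmc_o_incl R X m v)).
have [m1 Wm1] := cvg_has_output Ww; have [m2 wm2] := has_output_ex w.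
(* The alphabet must accommodate the limit as well as the terms, so that convergence can be
   reflected along [dmc_o_incl]. *)
pose m := maxn m1 m2.
have Wm n : has_output m (W n) by apply: has_output_le (Wm1 n); exact: leq_maxl.
have [v _ vw] : range (@dmc_o_incl R X m) w.
  by rewrite range_dmc_o_incl; apply: has_output_le wm2; exact: leq_maxr.
have /choice[u uW] : forall n, exists v : dmc_o R X 'I_m.+1,
    dmc_o_incl v = W n.
  move=> n; have : range (@dmc_o_incl R X m) (W n) by rewrite range_dmc_o_incl.
  by case=> u _ uE; exists u.
exists m; split=> //; exists u => //; exists v; apply: dmc_o_incl_cvg.
by rewrite vw; under eq_fun do rewrite uW.
Qed.
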